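(* Let $K$ be a field, let $m\ge 1$ be an integer, and let $f(X,Y)=a_0+a_1Y+\cdots+a_mY^m$, with $a_0,a_1,\ldots,a_m\in K[X]$ and $a_0a_m\neq 0$. If $d\in K[X]$ is a factor of $a_m$ such that $$\deg a_m>m\deg d+H_1(f),$$ then the polynomial $f(X,Y)$ has at most $\Omega(a_m/d)$ irreducible factors over $K(X)$.
   Context: For $f=a_0(X)+a_1(X)Y+\cdots+a_m(X)Y^m\in K[X,Y]$ with $a_m\ne 0$, $H_1(f)=\max\{\deg a_0,\ldots,\deg a_{m-1}\}$, where $\deg$ is the degree in $X$ (zero coefficients are ignored in the maximum, i.e. $\deg 0=-\infty$). For a nonzero polynomial $u\in K[X]$, $\Omega(u)$ denotes the number of irreducible factors of $u$ in $K[X]$, counting multiplicities, with $\Omega(c)=0$ for nonzero constants $c\in K$. ''Irreducible factors over $K(X)$'' refers to the ring $K(X)[Y]$. *)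

(* Defs.v *)
From HB Require Import structures.
From mathcomp Require Import all_boot all_order all_algebra.
From mathcomp Require Import boolp classical_sets.

Set Implicit Arguments.
Unset Strict Implicit.
Unset Printing Implicit Defensive.

Import GRing.Theory.
Local Open Scope ring_scope.

(* Junk value: deg 0 = 0. *)
Definition deg (K : fieldType) (p : {poly K}) : nat := (size p).-1.

(* {poly {poly K}} is K[X][Y]: f`_i is the coefficient a_i(X) of Y^i, and
   (size f).-1 is the degree m in Y. Zero coefficients are left out of the
   maximum, which is 0 if a_0, ..., a_(m-1) all vanish. *)
Definition H1 (K : fieldType) (f : {poly {poly K}}) : nat :=
  (\max_(i < (size f).-1 | (f`_i != 0)%R) deg (f`_i)%R)%N.

Definition irr_factorization (F : fieldType) (u : {poly F})
    (s : seq {poly F}) : Prop :=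
  (forall p, p \in s -> irreducible_poly p) /\
  exists2 c : F, c != 0 & u = c *: \prod_(p <- s) p.

(* Irreducible factors are counted with multiplicity; the length does not
   depend on the factorization, see Omega_unique. *)
Definition Omega (F : fieldType) (u : {poly F}) : nat :=
  xget 0%N [set n | exists2 s, irr_factorization u s & size s = n]%classic.

Lemma irr_factorization_exists (F : fieldType) (u : {poly F}) :
  u != 0 -> exists s, irr_factorization u s.
Proof.
have [n] := ubnP (size u); elim: n u => // n IHn u sz_u u_neq0.
have [/size_poly1P[c c_neq0 ->]|sz_neq1] := boolP (size u == 1%N).
  by exists [::]; split=> //; exists c => //; rewrite big_nil alg_polyC.
have sz_gt1 : (1 < size u)%N by rewrite ltn_neqAle eq_sym sz_neq1 size_poly_gt0.
have [irr_u|red_u] := pselect (irreducible_poly u).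
  exists [:: u]; split=> [p|]; first by rewrite inE => /eqP->.
  by exists 1; rewrite ?oner_neq0 // big_seq1 scale1r.
have [q [sz_q q_dvd qNu]] :
    exists q : {poly F}, [/\ size q != 1%N, q %| u & ~~ (q %= u)].
  apply: contrapT => noq; apply: red_u; split=> // q sz_q q_dvd.
  by apply/negPn/negP => qNu; apply: noq; exists q.
have def_u := divpK q_dvd; set r := u %/ q in def_u.
have q_neq0 : q != 0 by apply: contraNneq u_neq0 => q0; rewrite -def_u q0 mulr0.
have r_neq0 : r != 0 by apply: contraNneq u_neq0 => r0; rewrite -def_u r0 mul0r.
have sz_rq : size u = (size r + size q).-1 by rewrite -def_u size_mul.
have q_gt1 : (1 < size q)%N by rewrite ltn_neqAle eq_sym sz_q size_poly_gt0.
have q_lt : (size q < size u)%N.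
  by rewrite ltn_neqAle dvdp_leq // andbT dvdp_size_eqp.
have r_lt : (size r < size u)%N.
  by rewrite sz_rq -subn1 ltn_subRL add1n -addn1 addSnnS leq_add2l.
have [s1 [irr1 [c1 c1_neq0 def_r]]] := IHn r (leq_trans r_lt sz_u) r_neq0.
have [s2 [irr2 [c2 c2_neq0 def_q]]] := IHn q (leq_trans q_lt sz_u) q_neq0.
exists (s1 ++ s2); split=> [p|].
  by rewrite mem_cat => /orP[/irr1|/irr2].
exists (c1 * c2); first by rewrite mulf_neq0.
by rewrite -def_u def_r def_q big_cat /= -scalerAl -scalerAr scalerA.
Qed.

Lemma irr_dvd_prod (F : fieldType) (p : {poly F}) (s : seq {poly F}) :
  irreducible_poly p -> (forall q, q \in s -> irreducible_poly q) ->
  p %| \prod_(q <- s) q -> exists2 q, q \in s & p %= q.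
Proof.
move=> irr_p; elim: s => [|q s IHs] irr_s.
  rewrite big_nil dvdp1 => /eqP sz_p; have := irr_p.1.
  by rewrite sz_p.
rewrite big_cons; have [p_q|pNq] := boolP (p %| q).
  move=> _; exists q; first exact: mem_head.
  apply: (irr_s q (mem_head _ _)).2 => //.
  by rewrite neq_ltn irr_p.1 orbT.
have cop_pq : coprimep p q.
  rewrite /coprimep; apply: contraNT pNq => /irr_p.2 -/(_ (dvdp_gcdl p q)) eq_g.
  by rewrite -(eqp_dvdl _ eq_g) dvdp_gcdr.
rewrite Gauss_dvdpr // => /IHs[r r_s|r r_s p_r].
  by apply: irr_s; rewrite inE r_s orbT.
by exists r => //; rewrite inE r_s orbT.
Qed.

Lemma irr_factorization_size (F : fieldType) (u : {poly F})
    (s t : seq {poly F}) :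
  irr_factorization u s -> irr_factorization u t -> size s = size t.
Proof.
case=> irr_s [c c_neq0 def_s] [irr_t [d d_neq0 def_t]].
have {u c c_neq0 d d_neq0 def_s def_t} : \prod_(p <- s) p %= \prod_(p <- t) p.
  have e1 := eqp_scale (\prod_(p <- s) p) c_neq0.
  have e2 := eqp_scale (\prod_(p <- t) p) d_neq0.
  by rewrite -(eqp_rtrans e2) eqp_sym -(eqp_rtrans e1) -def_s -def_t eqpxx.
elim: s t irr_s irr_t => [|p s IHs] t irr_s irr_t.
  case: t irr_t => // q t irr_t; rewrite big_nil => e.
  have : q %| 1 by rewrite (eqp_dvdr _ e) big_cons dvdp_mulr.
  by rewrite dvdp1 => /eqP sz; have := (irr_t q (mem_head _ _)).1; rewrite sz.
move=> e; have irr_p := irr_s p (mem_head _ _).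
have : p %| \prod_(q <- t) q by rewrite -(eqp_dvdr _ e) big_cons dvdp_mulr.
case/(irr_dvd_prod irr_p irr_t) => q q_t p_q.
have perm_t := perm_to_rem q_t.
rewrite (perm_size perm_t) /=; congr _.+1; apply: IHs.
- by move=> r r_s; apply: irr_s; rewrite inE r_s orbT.
- by move=> r /mem_rem; apply: irr_t.
move: e; rewrite big_cons (perm_big _ perm_t) big_cons /= => e.
rewrite -(eqp_mul2l _ _ (irredp_neq0 irr_p)) (eqp_trans e) //.
by apply: eqp_mulr; rewrite eqp_sym.
Qed.

Lemma Omega_unique (F : fieldType) (u : {poly F}) (s : seq {poly F}) :
  irr_factorization u s -> Omega u = size s.
Proof.
move=> fs; apply: xget_unique => [|_ [t ft <-]]; first by exists s.
exact: irr_factorization_size ft fs.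
Qed.

Lemma OmegaP (F : fieldType) (u : {poly F}) :
  u != 0 -> exists2 s, irr_factorization u s & size s = Omega u.
Proof.
move=> /irr_factorization_exists[s fs].
by exists s => //; rewrite (Omega_unique fs).
Qed.

(* Main.v *)
Require Import Defs.
From mathcomp Require Import all_boot all_order all_algebra.
From mathcomp Require Import zify.
Import GRing.Theory.
Local Open Scope ring_scope.

(** Use [deg] as a valuation on K(X), and compare the roots of [f] in Y with
[D = deg d].  By the hypothesis on [deg a_m], the term of index [m] would
dominate all the others at a [y] with [deg y >= - D]; so every root [y] of [f],
in an algebraic closure of the completion of K(X) at infinity, satisfies
[deg y < - D].  Suppose that
[f = g_1 ... g_r] with every [g_j] in K[X][Y] of positive degree [n_j] in Y,
and let [b_j] and [c_j] be the leading and the constant coefficient of [g_j].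
Since [c_j / b_j] is, up to sign, the product of the roots of [g_j], one gets
[deg b_j > deg c_j + n_j * D >= D], where [c_j] is nonzero because [a_0] is.
So each of the [r] leading coefficients has degree larger than [d].

These leading coefficients multiply to [a_m = d * p_1 ... p_k], where
[k = Omega (a_m / d)] and the [p_i] are irreducible.  If [k < r], cancelling
the [p_i] one by one, each against one [b_j], leaves some [b_j] untouched;
that [b_j] divides [d], which its degree forbids ([pigeonhole_factor]).

Two ingredients make this precise.  Gauss's lemma replaces a factorization over
K(X) by one over K[X] with the same degrees in Y ([factors_over_poly_ring]):
clear denominators, then remove the irreducible factors of the common
denominator one at a time, each of them dividing all the coefficients of one
of the factors ([gauss_prime]).  The estimate of [deg b_j] is obtained without
roots or completions ([lead_coef_factor_large]), from the Newton polygon: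
consider the coefficient of [g] at which the weight [deg g_i - D * i] is
maximal, taking the smallest such index [i].  These indices add up in a product
([size_coefM_peak]); if the index of [g * h] is its degree in Y, then the index
of [g] is the degree of [g], and comparison with the constant coefficient
of [g] gives the estimate. *)

Set Implicit Arguments.
Unset Strict Implicit.

(** * From K(X) to K[X]: clearing denominators *)

Lemma tofrac_inj (R : idomainType) : injective (@FracField.tofrac R).
Proof. by move=> x y /eqP; rewrite tofrac_eq => /eqP. Qed.

Lemma frac_numden (R : idomainType) (x : {fraction R}) :
  exists a b : R, b != 0 /\ FracField.tofrac b * x = FracField.tofrac a.
Proof.
elim/quotW: x => x; exists (frac x).1, (frac x).2.
split; first exact: denom_ratioP.
apply/eqP; rewrite -[_ * _]/(FracField.mul _ _) !piE.
rewrite FracField.equivfE /FracField.mulf !numden_Ratio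
  ?mulf_neq0 ?oner_eq0 ?denom_ratioP //.
by rewrite mulr1 mul1r mulrC.
Qed.

Lemma clear_denominators (R : idomainType) (q : {poly {fraction R}}) :
  exists (b : R) (g : {poly R}),
    b != 0 /\ FracField.tofrac b *: q = map_poly (@FracField.tofrac R) g.
Proof.
elim/poly_ind: q => [|q x [b [g [b_neq0 def_q]]]].
  by exists 1, 0; rewrite oner_neq0 rmorph0 scaler0.
have [n [d [d_neq0 def_x]]] := frac_numden x.
exists (d * b), (d *: g * 'X + (b * n)%:P); split; first by rewrite mulf_neq0.
rewrite rmorphD /= -scalerAl map_polyZ [map_poly _ (g * _)]rmorphM /=.
rewrite map_polyX map_polyC /= -def_q.
rewrite scalerDr tofracM -scalerAl scalerA; congr (_ + _).
rewrite -mul_polyC -polyCM tofracM -def_x; congr (_%:P).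
by rewrite mulrCA mulrA.
Qed.

Lemma clear_denominators_prod (R : idomainType) (s : seq {poly {fraction R}}) :
  exists (b : R) (t : seq {poly R}),
    [/\ b != 0, [seq size (g : {poly R}) | g <- t]
            = [seq size (q : {poly {fraction R}}) | q <- s]
      & FracField.tofrac b *: \prod_(q <- s) q
        = map_poly (@FracField.tofrac R) (\prod_(g <- t) g)].
Proof.
elim: s => [|q s [b [t [b_neq0 sz_t def_s]]]].
  by exists 1, [::]; rewrite oner_neq0 !big_nil !rmorph1 scale1r.
have [c [g [c_neq0 def_q]]] := clear_denominators q.
exists (c * b), (g :: t); split; first by rewrite mulf_neq0.
  rewrite /= sz_t -(size_map_inj_poly (@tofrac_inj R) (rmorph0 _) g).
  by rewrite -def_q size_scale // tofrac_eq0.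
rewrite !big_cons [map_poly _ _]rmorphM tofracM /=.
by rewrite -def_q -def_s -scalerAl -scalerAr scalerA.
Qed.

(** * Irreducible polynomials are prime *)

Lemma irredp_dvdM (F : fieldType) (p a b : {poly F}) :
  irreducible_poly p -> p %| a * b -> (p %| a) || (p %| b).
Proof.
move=> irr_p; case: (boolP (p %| a)) => //= pNa.
by rewrite Gauss_dvdpr // irreducible_poly_coprime.
Qed.

Lemma irredp_dvd_prod (F : fieldType) (p : {poly F}) (s : seq {poly F}) :
  irreducible_poly p -> p %| \prod_(b <- s) b -> exists2 b, b \in s & p %| b.
Proof.
move=> irr_p; elim: s => [|b s IHs].
  by rewrite big_nil dvdp1 => /eqP sz_p; have := irr_p.1; rewrite sz_p.
rewrite big_cons => /(irredp_dvdM irr_p)/orP[p_b|/IHs[c c_s p_c]].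
  by exists b; rewrite ?mem_head.
by exists c; rewrite // inE c_s orbT.
Qed.

(** * Gauss's lemma for K[X][Y] *)

(** Reduce every coefficient of [g] and [h] modulo [p].  If both remainders were
nonzero, their leading coefficients would be nonzero of size less than
[size p], hence prime to [p], whereas [p] divides their product. *)
Lemma gauss_prime (F : fieldType) (p : {poly F}) (g h k : {poly {poly F}}) :
    irreducible_poly p -> g * h = p *: k ->
  (exists g', g = p *: g') \/ (exists h', h = p *: h').
Proof.
move=> irr_p def_gh; have p_neq0 := irredp_neq0 irr_p.
pose quo (u : {poly {poly F}}) := map_poly (fun a => a %/ p) u.
pose rmd (u : {poly {poly F}}) := map_poly (fun a => a %% p) u.
have division u : u = p *: quo u + rmd u.
  apply/polyP=> i; rewrite coefD coefZ !coef_map_id0 ?div0p ?mod0p //.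
  by rewrite mulrC -divp_eq.
have lead_rmd u : rmd u != 0 -> ~~ (p %| lead_coef (rmd u)).
  rewrite -lead_coef_eq0 => l_neq0; apply/negP => /(dvdp_leq l_neq0).
  by rewrite lead_coefE coef_map_id0 ?mod0p // leqNgt ltn_modp p_neq0.
have [rg0|rg_neq0] := eqVneq (rmd g) 0.
  by left; exists (quo g); rewrite {1}(division g) rg0 addr0.
have [rh0|rh_neq0] := eqVneq (rmd h) 0.
  by right; exists (quo h); rewrite {1}(division h) rh0 addr0.
have : p %| lead_coef (rmd g * rmd h).
  have -> : rmd g * rmd h = p *: (k - quo g * h - rmd g * quo h).
    have rmdE u : rmd u = u - p *: quo u by rewrite {2}(division u) addrC addKr.
    rewrite !scalerBr -def_gh scalerAl -mulrBl -(rmdE g).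
    by rewrite scalerAr -mulrBr -(rmdE h).
  by rewrite lead_coefE coefZ dvdp_mulr.
rewrite lead_coefM => /(irredp_dvdM irr_p).
by rewrite (negPf (lead_rmd _ rg_neq0)) (negPf (lead_rmd _ rh_neq0)).
Qed.

Lemma gauss_prime_prod (F : fieldType) (p : {poly F})
    (s : seq {poly {poly F}}) (k : {poly {poly F}}) :
    irreducible_poly p -> \prod_(g <- s) g = p *: k ->
  exists2 g, g \in s & exists g', g = p *: g'.
Proof.
move=> irr_p; elim: s k => [|g s IHs] k.
  rewrite big_nil => def_1; suff: p %| 1.
    by rewrite dvdp1 => /eqP sz_p; have := irr_p.1; rewrite sz_p.
  have <- : (1 : {poly {poly F}})`_0 = 1 by rewrite coef1.
  by rewrite def_1 coefZ dvdp_mulr.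
rewrite big_cons => /(gauss_prime irr_p)[g'|[h def_s]].
  by exists g; rewrite ?mem_head.
have [u u_s u'] := IHs _ def_s.
by exists u; rewrite // inE u_s orbT.
Qed.

(** A common multiplier with prime factors [t] can be removed from a
factorization without changing the number of factors.  Each prime of [t] is
divided out of a single factor, by a scalar of K[X], so that no degree in Y
changes; hence the condition on sizes survives. *)
Lemma gauss_descent (F : fieldType) (t : seq {poly F}) (f : {poly {poly F}})
    (s : seq {poly {poly F}}) :
    (forall p, p \in t -> irreducible_poly p) ->
    (forall g, g \in s -> (1 < size g)%N) ->
    (\prod_(p <- t) p) *: f = \prod_(g <- s) g ->
  exists s' : seq {poly {poly F}},
    [/\ size s' = size s, forall g, g \in s' -> (1 < size g)%N
    & f = \prod_(g <- s') g].
Proof.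
elim: t s => [|p t IHt] s irr_t gt1_s def_s.
  by exists s; rewrite -def_s big_nil scale1r.
have irr_p := irr_t p (mem_head _ _); have p_neq0 := irredp_neq0 irr_p.
rewrite big_cons -scalerA in def_s.
have [g g_s [g' def_g]] := gauss_prime_prod irr_p (esym def_s).
have perm_s := perm_to_rem g_s.
rewrite (perm_size perm_s); apply: (IHt (g' :: rem g s)).
- by move=> q q_t; apply: irr_t; rewrite inE q_t orbT.
- move=> u; rewrite inE => /orP[/eqP->|/mem_rem/gt1_s//].
  by have := gt1_s g g_s; rewrite def_g size_scale.
have pC_neq0 : p%:P != 0 by rewrite polyC_eq0.
apply: (mulfI pC_neq0); rewrite !mul_polyC def_s (perm_big _ perm_s) !big_cons.
by rewrite scalerAl -def_g.
Qed.

(** The factorization of the image of [f] comes with a scalar of K(X), and the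
removal of denominators with a scalar of K.  Both go into the first factor,
which is why [s] has to be nonempty: a constant [f] other than 1 gives [s]
empty without being the empty product. *)
Lemma factors_over_poly_ring (K : fieldType) (f : {poly {poly K}})
    (s : seq {poly {fraction {poly K}}}) :
    s != [::] -> f != 0 ->
    irr_factorization (map_poly (@FracField.tofrac {poly K}) f) s ->
  exists t : seq {poly {poly K}},
    [/\ size t = size s, forall g, g \in t -> (1 < size g)%N
      & f = \prod_(g <- t) g].
Proof.
move=> s_neq0 f_neq0 [irr_s [z z_neq0 def_f]].
have [n [d [d_neq0 def_z]]] := frac_numden z.
have n_neq0 : n != 0.
  rewrite -tofrac_eq0 -def_z; apply: mulf_neq0 z_neq0.
  by rewrite tofrac_eq0.
have [b [t [b_neq0 sz_t def_t]]] := clear_denominators_prod s.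
have gt1_t g : g \in t -> (1 < size g)%N.
  have /allP gt1 : all (fun k => 1 < k)%N
      [seq size (g : {poly {poly K}}) | g <- t].
    by rewrite sz_t; apply/allP => _ /mapP[q /irr_s irr_q ->]; apply: irr_q.1.
  by move=> g_t; apply: gt1; apply: map_f.
have {}sz_t : size t = size s by have := congr1 size sz_t; rewrite !size_map.
have {def_z def_f} {}def_t : (d * b) *: f = n *: \prod_(g <- t) g.
  apply: (map_inj_poly (@tofrac_inj {poly K}) (rmorph0 _)).
  rewrite !map_polyZ /= -def_t def_f !scalerA tofracM -def_z.
  by congr (_ *: _); rewrite mulrAC.
case: t sz_t gt1_t def_t => [/esym/size0nil/eqP|g t sz_t gt1_t def_t].
  by rewrite (negPf s_neq0).
have [p_s [irr_p [c c_neq0 def_db]]] :=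
  irr_factorization_exists (mulf_neq0 d_neq0 b_neq0).
have [||t' [sz_t' gt1_t' def_t']] :=
    @gauss_descent _ p_s f ((c^-1 *: n) *: g :: t) irr_p.
- move=> u; rewrite inE => /orP[/eqP->|u_t].
    rewrite size_scale ?gt1_t ?mem_head //.
    by rewrite -mul_polyC mulf_neq0 ?polyC_eq0 ?invr_eq0.
  by rewrite gt1_t // inE u_t orbT.
- have -> : \prod_(p <- p_s) p = c^-1 *: (d * b).
    by rewrite def_db scalerA mulVf // scale1r.
  rewrite -[_ *: (d * b)]mul_polyC -scalerA def_t scalerA mul_polyC.
  by rewrite !big_cons scalerAl.
by exists t'; rewrite sz_t'.
Qed.

(** * Newton polygons and the leading coefficients of factors *)

(** The index [i] is where the weight [deg g`_j - D * j] is maximal, and the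
smallest such index: the boolean [j < i], read as a number, makes the
inequality strict on the left of [i].  Geometrically, [i] is the first contact
point of the upper Newton polygon of [g] with its supporting line of slope
[D]. *)
Definition peak (R : idomainType) (D : nat) (g : {poly {poly R}})
    (i : nat) : Prop :=
  g`_i != 0 /\ forall j, g`_j != 0 ->
    (size (g`_j)%R + D * i + (j < i) <= size (g`_i)%R + D * j)%N.

Lemma peak_exists (R : idomainType) (D : nat) (g : {poly {poly R}}) :
  g != 0 -> exists i, peak D g i.
Proof.
move=> g_neq0; set n := size g.
have n_gt0 : (0 < n)%N by rewrite size_poly_gt0.
have ln : (n.-1 < n)%N by lia.
(* A lexicographic maximum in a single number: the weight of [i], shifted by
   [D * n] to stay in the natural numbers, then [n - i <= n] to break ties in
   favour of the smallest index. *)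
pose key (i : 'I_n) := ((size (g`_i)%R + D * (n - i)) * n.+1 + (n - i))%N.
have P0 : g`_(Ordinal ln) != 0 by rewrite -lead_coefE lead_coef_eq0.
case: (@arg_maxnP _ (Ordinal ln) (fun i : 'I_n => g`_i != 0) key P0).
move=> i gi_neq0 max_i; exists (val i); split=> // j gj_neq0.
have lt_jn : (j < n)%N.
  by rewrite ltnNge; apply: contra gj_neq0 => /(nth_default 0)->.
have lt_in := ltn_ord i.
have {max_i} := max_i (Ordinal lt_jn) gj_neq0; rewrite /key /=.
have split_n k : (k < n)%N -> (D * n = D * (n - k) + D * k)%N.
  by move=> lt_kn; rewrite -mulnDr subnK // ltnW.
have := split_n i lt_in; have := split_n j lt_jn.
move=> split_j split_i; set A := addn _ (D * (n - i)).
set B := addn _ (D * (n - j)).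
move=> le_key; suff : (B + (j < i) <= A)%N by lia.
case: ltnP => [lt_ji|_] /=.
  suff : (B * n.+1 < A * n.+1)%N by rewrite ltn_pmul2r ?addn1.
  by lia.
suff : (B * n.+1 < A.+1 * n.+1)%N by rewrite ltn_pmul2r ?addn0.
by rewrite mulSn; lia.
Qed.

(** The coefficient of index [i + j] is the sum of the [g`_k * h`_(i + j - k)],
and the term [k = i] is strictly larger than the others: when [k != i], one of
[k < i] and [i + j - k < j] holds, so one of the two bounds is strict. *)
Lemma size_coefM_peak (R : idomainType) (D : nat) (g h : {poly {poly R}})
    (i j : nat) :
    peak D g i -> peak D h j ->
  size (g * h)`_(i + j) = (size g`_i + size h`_j).-1.
Proof.
move=> [gi_neq0 max_i] [hj_neq0 max_j].
pose cg k : nat := size (g`_k)%R; pose ch k : nat := size (h`_k)%R.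
have sz_mul a b : g`_a != 0 -> h`_b != 0 ->
    size (g`_a * h`_b) = (cg a + ch b).-1 by exact: size_mul.
have cg_gt0 k : g`_k != 0 -> (0 < cg k)%N by rewrite size_poly_gt0.
have ch_gt0 k : h`_k != 0 -> (0 < ch k)%N by rewrite size_poly_gt0.
have cg_i := cg_gt0 _ gi_neq0; have ch_j := ch_gt0 _ hj_neq0.
have {}max_i k : g`_k != 0 -> (cg k + D * i + (k < i) <= cg i + D * k)%N.
  exact: max_i.
have {}max_j k : h`_k != 0 -> (ch k + D * j + (k < j) <= ch j + D * k)%N.
  exact: max_j.
have lt_i : (i < (i + j).+1)%N by rewrite ltnS leq_addr.
rewrite coefM (bigD1 (Ordinal lt_i)) //= addKn size_polyDl sz_mul //.
rewrite (leq_ltn_trans (size_sum _ _ _)) //.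
rewrite -[X in (_ < X)%N]prednK; last by lia.
rewrite ltnS; apply/bigmax_leqP => k k_neq_i.
have lt_k := ltn_ord k.
have neq_ki : (k : nat) <> i by move=> ki; case/eqP: k_neq_i; apply: val_inj.
have [->|gk_neq0] := eqVneq g`_k 0; first by rewrite mul0r size_poly0.
have [->|hk_neq0] := eqVneq h`_(i + j - k) 0; first by rewrite mulr0 size_poly0.
rewrite sz_mul //.
have := max_i _ gk_neq0; have := max_j _ hk_neq0; have := cg_gt0 _ gk_neq0.
have split_D : (D * k + D * (i + j - k) = D * i + D * j)%N.
  by rewrite -!mulnDr; congr (_ * _)%N; lia.
have : (k < i)%N || (i + j - k < j)%N by lia.
by case/orP => ->; lia.
Qed.

(** The first hypothesis says that the peak of [g * h] is its top coefficient.
Peaks add up, so the peak of [g] is at the top as well, and comparing it with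
the nonzero constant coefficient of [g] gives
[deg (lead_coef g) > D * deg_Y g >= D]. *)
Lemma lead_coef_factor_large (R : idomainType) (D : nat)
    (g h : {poly {poly R}}) :
    (forall i, (i < (size (g * h)%R).-1)%N -> (g * h)`_i != 0 ->
      (size ((g * h)`_i)%R + D * (size (g * h)%R).-1
        < size (lead_coef (g * h)%R) + D * i)%N) ->
    (g * h)`_0 != 0 -> (1 < size g)%N ->
  (D.+1 < size (lead_coef g))%N.
Proof.
move=> top_dominates gh0_neq0 sz_g.
have g0_neq0 : g`_0 != 0.
  by apply: contraNneq gh0_neq0 => g0; rewrite coef0M g0 mul0r.
have gh_neq0 : g * h != 0 by apply: contraNneq gh0_neq0 => ->; rewrite coef0.
have [g_neq0 h_neq0] : g != 0 /\ h != 0.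
  by apply/andP; rewrite -negb_or -mulf_eq0.
pose n := (size g).-1; pose l := (size h).-1.
have n_gt0 : (0 < n)%N by rewrite /n -ltnS prednK // ltnW.
have [gn_neq0 hl_neq0] : g`_n != 0 /\ h`_l != 0.
  by rewrite -!lead_coefE !lead_coef_eq0.
have sz_gh : (size (g * h)%R).-1 = (n + l)%N.
  by rewrite size_mul // (polySpred g_neq0) (polySpred h_neq0) addnS addSn.
have [i peak_i] := peak_exists D g_neq0.
have [j peak_j] := peak_exists D h_neq0.
pose cg k : nat := size (g`_k)%R; pose ch k : nat := size (h`_k)%R.
have sz_ij : size (g * h)`_(i + j) = (cg i + ch j).-1.
  exact: size_coefM_peak peak_i peak_j.
have sz_top : size (lead_coef (g * h)) = (cg n + ch l).-1.
  by rewrite lead_coefM; apply: size_mul.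
case: peak_i peak_j => gi_neq0 max_i [hj_neq0 max_j].
have cg_gt0 k : g`_k != 0 -> (0 < cg k)%N by rewrite size_poly_gt0.
have ch_gt0 k : h`_k != 0 -> (0 < ch k)%N by rewrite size_poly_gt0.
have {}max_i k : g`_k != 0 -> (cg k + D * i + (k < i) <= cg i + D * k)%N.
  exact: max_i.
have {}max_j k : h`_k != 0 -> (ch k + D * j + (k < j) <= ch j + D * k)%N.
  exact: max_j.
have le_top (u : {poly {poly R}}) k : u`_k != 0 -> (k <= (size u).-1)%N.
  move=> uk_neq0; rewrite -ltnS; apply: (leq_trans _ (leqSpred _)).
  by rewrite ltnNge; apply: contra uk_neq0 => /(nth_default 0)->.
have le_i : (i <= n)%N := le_top _ _ gi_neq0.
have le_j : (j <= l)%N := le_top _ _ hj_neq0.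
have gn_gt0 := cg_gt0 _ gn_neq0; have hl_gt0 := ch_gt0 _ hl_neq0.
have gi_gt0 := cg_gt0 _ gi_neq0; have hj_gt0 := ch_gt0 _ hj_neq0.
have top_lt : (i + j < n + l)%N -> (0 < (cg i + ch j).-1)%N ->
    ((cg i + ch j).-1 + (D * n + D * l)
      < (cg n + ch l).-1 + (D * i + D * j))%N.
  rewrite -sz_ij -sz_top -!mulnDr -sz_gh size_poly_gt0.
  exact: top_dominates.
have cmp_n := max_i n gn_neq0; have cmp_l := max_j l hl_neq0.
have cmp_0 := max_i 0%N g0_neq0; have cg0_gt0 := cg_gt0 _ g0_neq0.
have le_D : (D <= D * n)%N by rewrite leq_pmulr.
rewrite -[size (lead_coef g)]/(cg n).
(* If the peak [i] of [g] were not at the top, [i + j] would be below the top of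
   [g * h], and [top_lt] would contradict [cmp_n] and [cmp_l]; then [cmp_0]
   gives the conclusion. *)
clearbody cg ch n l.
clear - n_gt0 le_i le_j gn_gt0 hl_gt0 gi_gt0 hj_gt0 cg0_gt0
  top_lt cmp_n cmp_l cmp_0 le_D.
have [i_top|i_neq_n] := eqVneq i n.
  by move: cmp_0; rewrite i_top n_gt0; lia.
have ij_lt : (i + j < n + l)%N by lia.
have := top_lt ij_lt; lia.
Qed.

(** * Cancelling prime factors *)

(** Each of the fewer primes of [t] is cancelled against at most one element of
[s], which is then discarded; an element that survives to the end divides what
is left of the right-hand side, that is [d]. *)
Lemma pigeonhole_factor (F : fieldType) (d : {poly F}) (s t : seq {poly F}) :
    (forall p, p \in t -> irreducible_poly p) -> (size t < size s)%N ->
    \prod_(b <- s) b %| d * \prod_(p <- t) p ->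
  exists2 b, b \in s & b %| d.
Proof.
elim: t s => [|p t IHt] s irr_t lt_ts.
  case: s lt_ts => // b s _; rewrite big_nil mulr1 big_cons => dvd_d.
  exists b; rewrite ?mem_head //; apply: dvdp_trans dvd_d.
  exact: dvdp_mulr.
have irr_p := irr_t p (mem_head _ _); have p_neq0 := irredp_neq0 irr_p.
have {}irr_t q : q \in t -> irreducible_poly q.
  by move=> q_t; apply: irr_t; rewrite inE q_t orbT.
rewrite big_cons mulrCA; case: (boolP (p %| \prod_(b <- s) b)) => [|pNs].
  case/(irredp_dvd_prod irr_p) => b b_s /dvdpP[b' def_b] dvd_s.
  have perm_s := perm_to_rem b_s.
  have [||c c_s c_d] := IHt (rem b s) irr_t.
  - by move: lt_ts; rewrite (perm_size perm_s).
  - move: dvd_s; rewrite (perm_big _ perm_s) big_cons {1}def_b /= mulrAC.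
    rewrite [p * _]mulrC dvdp_mul2r //; apply: dvdp_trans.
    exact: dvdp_mull.
  by exists c; rewrite // (mem_rem c_s).
rewrite Gauss_dvdpr; last first.
  by rewrite coprimep_sym irreducible_poly_coprime.
by apply: IHt => //; apply: ltnW.
Qed.

(** * Number of irreducible factors *)

Unset Implicit Arguments.

Theorem corollary1 (K : fieldType) (m : nat) (f : {poly {poly K}})
    (d : {poly K}) :
  (1 <= m)%N ->
  (size f <= m.+1)%N ->
  f`_0 * f`_m != 0 ->
  d %| f`_m ->
  (m * deg d + H1 f < deg f`_m)%N ->
  (Omega (map_poly (@FracField.tofrac {poly K}) f) <= Omega (f`_m %/ d))%N.
Proof.
move=> m_gt0 le_sz f0m_neq0 d_fm lt_deg.
have [f0_neq0 fm_neq0] : f`_0 != 0 /\ f`_m != 0.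
  by apply/andP; rewrite -negb_or -mulf_eq0.
have sz_f : size f = m.+1.
  apply/eqP; rewrite eqn_leq le_sz ltnNge.
  by apply: contra fm_neq0 => /(nth_default 0)->.
have f_neq0 : f != 0 by rewrite -size_poly_eq0 sz_f.
have mapf_neq0 : map_poly (@FracField.tofrac {poly K}) f != 0.
  by rewrite -size_poly_eq0 (size_map_inj_poly (@tofrac_inj {poly K})) ?sz_f.
have d_neq0 : d != 0.
  by apply: contraNneq fm_neq0 => d0; move: d_fm; rewrite d0 dvd0p.
have fmd_neq0 : f`_m %/ d != 0.
  by apply: contraNneq fm_neq0 => q0; rewrite -(divpK d_fm) q0 mul0r.
have [s irr_s <-] := OmegaP mapf_neq0.
have [t [irr_t [e e_neq0 def_t]] <-] := OmegaP fmd_neq0.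
rewrite leqNgt; apply/negP => lt_ts.
have s_neq0 : s != [::] by apply: contraTneq lt_ts => ->; rewrite ltn0.
have [u [sz_u gt1_u def_u]] :=
  factors_over_poly_ring s_neq0 f_neq0 irr_s.
have lead_u : \prod_(b <- [seq lead_coef g | g <- u]) b = f`_m.
  rewrite big_map -(big_morph (@lead_coef _) (@lead_coefM _) (@lead_coef1 _)).
  by rewrite -def_u lead_coefE sz_f.
have [||b /mapP[g g_u ->] g_d] :=
    @pigeonhole_factor _ d [seq lead_coef g | g <- u] t irr_t.
- by rewrite size_map sz_u.
- rewrite lead_u -{1}(divpK d_fm) def_t mulrC.
  by rewrite dvdp_mul2l // dvdpZl.
have [r def_gh] : exists r, f = g * r.
  exists (\prod_(h <- rem g u) h).
  by rewrite def_u (perm_big _ (perm_to_rem g_u)) big_cons.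
have : ((deg d).+1 < size (lead_coef g))%N.
  apply: (@lead_coef_factor_large _ _ _ r); last exact: gt1_u.
    rewrite -def_gh lead_coefE sz_f => i lt_im fi_neq0.
    have lt_i : (i < (size f).-1)%N by rewrite sz_f.
    have le_H1 : (deg (f`_i)%R <= H1 f)%N.
      exact: (leq_bigmax_cond (Ordinal lt_i)).
    have fi_gt0 : (0 < size (f`_i)%R)%N by rewrite size_poly_gt0.
    have arith x y z k : (m * z + k < y.-1)%N -> (x.-1 <= k)%N -> (0 < x)%N ->
      (x + z * m < y + z * i)%N by lia.
    exact: arith lt_deg le_H1 fi_gt0.
  by rewrite -def_gh.
by have := dvdp_leq d_neq0 g_d; rewrite /deg (polySpred d_neq0) ltnNge => ->.
Qed.
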